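(* Let $M$ be a feed-forward neural-network classifier with ReLU hidden nodes, $K\subseteq X_0$ its set of sensitive input nodes, $Y$ a set of initial states of interest, $\mathcal A_1,\mathcal A_2$ numerical abstract domains with sound operations (over real-valued nodes), and $L,U$ the lower and upper budget bounds. If the procedure $\mathrm{ANALYZE}(M,K,Y,\mathcal A_1,\mathcal A_2,L,U)$ described in the context returns $(C,\mathrm{true},\emptyset,E)$, i.e. a set $C$ of completed input regions, an empty set $B=\emptyset$ of possibly biased regions, and some collection $E$ of excluded regions, then $M$ satisfies causal fairness $\mathcal F_K[Y]$ over the input-space fraction $C$; that is, $\mathrm{unused}_K\big(\llbracket M\rrbracket^{\bigcup C}\big)$ holds.
   Context: **Networks.** A feed-forward network $M$ has layers $0,\dots,N$; $X$ is the set of all nodes, $X_i$ the nodes of layer $i$, $x_{i,j}$ the $j$-th node of layer $i$. Each non-input node has value $f(\sum_k w^i_{j,k}x_{i-1,k}+b_{i,j})$ with $f=\mathrm{ReLU}$, $\mathrm{ReLU}(x)=\max(x,0)$, for hidden nodes and $f=\mathrm{id}$ for output nodes. $|M|$ is the number of hidden nodes. The output nodes are the target classes. A state is a map $s:X\to\mathbb R$; $\Sigma$ is the set of states. The execution of $M$, which computes the nodes one after the other, layer by layer, is modelled by an acyclic transition relation on $\Sigma$; a trace is a non-empty finite sequence of states following this relation. The final states (those without successors) are partitioned into a set $\mathbb O$ of outcomes, according to the output node with the highest value. $\llbracket M\rrbracket$ is the set of all non-empty traces ending in a final state. For a trace $\sigma$, $\sigma_0$ and $\sigma_\omega$ are its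 first and last states; $\sigma_\omega\equiv\sigma'_\omega$ means they lie in the same outcome. For a set of traces $T$ and $Z\subseteq\Sigma$, $T^Z=\{\sigma\in T\mid \sigma_0\in Z\}$. **Causal fairness.** $K\subseteq X_0$ is the set of sensitive input nodes, $\overline K=X_0\setminus K$. $s=_{\overline K}s'$ means that $s,s'$ agree on $\overline K$. $\mathbb V$ is the set of all possible value choices for the sensitive inputs; each $v\in\mathbb V$ is a non-empty subset of $\mathbb R^K$ (a singleton for each value of a one-hot encoded categorical input; e.g. an interval for continuous inputs). For a set of traces $T$, $$\mathrm{unused}_K(T)\iff\forall\sigma\in T\ \forall v\in\mathbb V:\ \sigma_0|_K\notin v\Rightarrow\exists\sigma'\in T:\ \sigma_0=_{\overline K}\sigma'_0\ \wedge\ \sigma'_0|_K\in v\ \wedge\ \sigma_\omega\equiv\sigma'_\omega .$$ For a set $Z$ of initial states, causal fairness on $Z$ is the property $\mathcal F_K[Z]=\{\llbracket M'\rrbracket^Z\mid M'\text{ a neural-network model},\ \mathrm{unused}_K(\llbracket M'\rrbracket^Z)\}$; $M$ satisfies it iff $\mathrm{unused}_K(\llbracket M\rrbracket^Z)$. **Abstract domains.** An element of an abstract domain represents (via concretization $\gamma$) a set of states or of partial states. All operations (restriction to a set of states, assignment, ReLU, assumption that a given output node has the highest value, projection, meet $\sqcap$) are sound, i.e. over-approximate the corresponding concrete operations; in particular $\gamma(a)\cap\gamma(a')\subseteq\gamma(a\sqcap a')$ and $\gamma(\bot)=\emptyset$. **Abstract activation patterns.** An abstract activation pattern $p$ fixes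 the status (active or inactive) of a subset of the ReLUs of $M$; $|p|$ is the number of fixed ReLUs, and $p$ represents all full activation patterns agreeing with it. $p$ is subsumed by $p'$ if all statuses fixed by $p'$ are fixed identically by $p$. **ANALYZE.** (1) *Forward pre-analysis.* Initialize the worklist $\mathbb P=\{Y\}$ and $F,E,C$ empty. While $\mathbb P\neq\emptyset$, remove some $I\in\mathbb P$. Propagate $I$ forward through the network in $\mathcal A_1$, obtaining an element $a$ that over-approximates the values reachable from $I$, and an abstract activation pattern $p$ containing only statuses established by the propagation to hold for all executions from $I$. If $a$ implies that a single outcome is possible for all executions from $I$, add $I$ to $C$. Else, if $|M|-|p|\le U$, insert $p\mapsto I$ into the map $F$ from patterns to sets of regions (where regions whose patterns are subsumed by another pattern in $F$ are grouped under the latter). Else, if the size of $I$ is $\le L$, insert $p\mapsto I$ into $E$ (excluded). Else, add to the worklist the regions obtained by partitioning $I$ further along non-sensitive input dimensions (those in $\overline K$). (2) *Backward analysis.* Set $B=\emptyset$. For each pattern $p$ in $F$ with its group of regions: for each output node $x_{N,j}$, compute backwards through the network in $\mathcal A_2$, starting from the assumption that $x_{N,j}$ has the highest output value, an element $a_j$; at each ReLU only the branch prescribed by $p$ is explored if $p$ fixes its status, and both branches otherwise. Thus $a_j$ over-approximates the set of initial states whose execution has an activation pattern represented by $p$ and has outcome $x_{N,j}$. For each region $I$ in the group, let $a_j^I$ be the projection onto $\overline K$ of the restriction of $a_j$ to $I$; add to $B$ every $a_j^I\sqcap a_{j'}^I\ne\bot$ with $j\neq j'$; and add $I$ to $C$.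 (3) Return $(C,\ B=\emptyset,\ B,\ E)$, the second component being a truth value.
   Formalization: Adds that Y leaves the sensitive inputs free: from each state of Y, every value choice v in 𝕍 is met by some state of Y with the same non-sensitive inputs. Without it the claim fails, e.g. for Y a single state and 𝕍 = {{0},{1}}. *)

(* Defs.v *)
From HB Require Import structures.
From mathcomp Require Import all_boot all_order all_algebra.
From mathcomp Require Import boolp classical_sets cardinality reals.
From Stdlib Require Import Relation_Operators.

Set Implicit Arguments.
Unset Strict Implicit.
Unset Printing Implicit Defensive.

Import Order.TTheory GRing.Theory Num.Theory.
Local Open Scope classical_set_scope.
Local Open Scope ring_scope.

(* Layers 0, ..., N with N = (nhidden S).+1: layer 0 is the input layer and
   layer N the output layer. Only [width S i] for i <= N is relevant. *)
Record arch := Arch { nhidden : nat ; width : nat -> nat }.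

Definition node (S : arch) : Type :=
  {i : 'I_(nhidden S).+2 & 'I_(width S i)}.
HB.instance Definition _ S := Finite.on (node S).

(* [existT _ i j : cnode S] is the j-th node of layer i.+1 (and not i). *)
Definition cnode (S : arch) : Type :=
  {i : 'I_(nhidden S).+1 & 'I_(width S i.+1)}.
HB.instance Definition _ S := Finite.on (cnode S).

Definition is_hidden S (x : cnode S) : bool := (tag x < nhidden S)%N.

Definition hnode (S : arch) : Type := {x : cnode S | is_hidden x}.
HB.instance Definition _ S := Finite.on (hnode S).
HB.instance Definition _ S := SubType.on (hnode S).

Definition inode (S : arch) : Type := 'I_(width S 0).
HB.instance Definition _ S := Finite.on (inode S).

Definition onode (S : arch) : Type := 'I_(width S (nhidden S).+1).
HB.instance Definition _ S := Finite.on (onode S).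

Definition layer_node S (i : nat) (lti : (i < (nhidden S).+2)%N)
  (j : 'I_(width S i)) : node S :=
  existT (fun i : 'I_(nhidden S).+2 => 'I_(width S i)) (Ordinal lti) j.

Definition input S (k : inode S) : node S := layer_node (ltn0Sn _) k.
Definition output S (j : onode S) : node S := layer_node (ltnSn _) j.
Definition node_of S (x : cnode S) : node S :=
  layer_node (i := (tag x).+1) (ltn_ord (tag x)) (tagged x).

(* The node of layer [tag x] with index k, i.e. a node feeding x. *)
Definition pred_node S (x : cnode S) (k : 'I_(width S (tag x))) : node S :=
  layer_node (ltnW (ltn_ord (tag x)) : (tag x < (nhidden S).+2)%N) k.

(* Execution order: layer by layer, and by index inside a layer. *)
Definition exec_order S : seq (cnode S) :=
  [seq existT (fun i : 'I_(nhidden S).+1 => 'I_(width S i.+1)) i j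
  | i <- enum 'I_(nhidden S).+1, j <- enum 'I_(width S i.+1)].

Record network (R : realType) (S : arch) := Network {
  weight : forall i : 'I_(nhidden S).+1, 'M[R]_(width S i.+1, width S i) ;
  bias : forall i : 'I_(nhidden S).+1, 'cV[R]_(width S i.+1) }.

Definition relu (R : realType) (x : R) : R := Num.max x 0.

Section Semantics.
Variables (R : realType) (S : arch).

Definition state : Type := node S -> R.

Definition update (s : state) (x : node S) (r : R) : state :=
  fun y => if y == x then r else s y.

Definition preact (M : network R S) (s : state) (x : cnode S) : R :=
  \sum_(k < width S (tag x)) weight M (tag x) (tagged x) k * s (pred_node k)
  + bias M (tag x) (tagged x) 0.

Definition node_value (M : network R S) (s : state) (x : cnode S) : R :=
  if is_hidden x then relu (preact M s x) else preact M s x.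

(* A state has no program counter: the next node to be computed is the first
   one, in execution order, whose value is not the one prescribed by M.
   Recomputing a node that already holds its value would be a self-loop, so
   such nodes are skipped; the final states are those in which every
   non-input node holds its value. *)
Definition step (M : network R S) (s t : state) : Prop :=
  exists xs x ys,
    [/\ exec_order S = xs ++ x :: ys,
        {in xs, forall y, s (node_of y) = node_value M s y},
        s (node_of x) <> node_value M s x
      & t = update s (node_of x) (node_value M s x)].

Definition final (M : network R S) (s : state) : Prop :=
  forall t, ~ step M s t.

(* A non-empty sequence of states, as its head and its tail. *)
Definition trace : Type := (state * seq state)%type.
Definition first_state (sigma : trace) : state := sigma.1.
Definition last_state (sigma : trace) : state := last sigma.1 sigma.2.

Definition traces (M : network R S) : set trace :=
  [set sigma | path (fun s t => `[< step M s t >]) sigma.1 sigma.2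
               /\ final M (last_state sigma)].

Definition starting_in (T : set trace) (Z : set state) : set trace :=
  [set sigma | T sigma /\ Z (first_state sigma)].

(* [win] maps the values of the output nodes to an output node with the
   highest value; it only has a choice to make in case of a tie. *)
Definition argmax_rule (win : (onode S -> R) -> onode S) : Prop :=
  forall y k, y k <= y (win y).

Definition output_values (s : state) : onode S -> R := fun j => s (output j).

(* The outcomes are the sets of final states with a given winning node. *)
Definition same_outcome (win : (onode S -> R) -> onode S) (s t : state) :=
  win (output_values s) = win (output_values t).

Definition inputs (D : {set inode S}) : Type := {k : inode S | k \in D} -> R.

Definition restr_inputs (D : {set inode S}) (s : state) : inputs D :=
  fun k => s (input (sval k)).

Definition eq_inputs (D : {set inode S}) (s t : state) : Prop :=
  forall k, k \in D -> s (input k) = t (input k).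

Definition unused win (K : {set inode S}) (V : set (set (inputs K)))
    (T : set trace) : Prop :=
  forall sigma, T sigma -> forall v, V v ->
  ~ v (restr_inputs (first_state sigma)) ->
  exists sigma', [/\ T sigma',
    eq_inputs (~: K) (first_state sigma) (first_state sigma'),
    v (restr_inputs (first_state sigma'))
  & same_outcome win (last_state sigma) (last_state sigma')].

Definition causal_fairness win K V (Z : set state) : set (set trace) :=
  [set T | exists M' : network R S,
     T = starting_in (traces M') Z /\ @unused win K V T].

(* Z leaves the sensitive inputs free: each value choice can be realized
   without leaving Z and without changing the non-sensitive inputs. *)
Definition sensitive_free (K : {set inode S})
    (V : set (set (inputs K))) (Z : set state) : Prop :=
  forall s, Z s -> forall v, V v ->
  exists s', [/\ Z s', eq_inputs (~: K) s s' & v (restr_inputs s')].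

(* A partial state is undefined (None) on the nodes projected away. *)
Definition pstate : Type := node S -> option R.
Definition of_state (s : state) : pstate := fun x => Some (s x).
Definition pproj (D : {set node S}) (t : pstate) : pstate :=
  fun x => if x \in D then t x else None.

(* An active ReLU acts as the identity and an inactive one returns 0; both
   are true of a ReLU whose argument r is 0. *)
Definition has_status (r : R) (b : bool) : Prop :=
  if b then 0 <= r else r <= 0.

(* The operations needed to analyze M. The argument of [brelu] of type
   [option bool] is the branch to explore, None standing for both. *)
Record abstract_domain (M : network R S) := AbstractDomain {
  elem :> Type ;
  gamma : elem -> set pstate ;
  top : elem ;
  bot : elem ;
  meet : elem -> elem -> elem ;
  restrict : set state -> elem -> elem ;
  project : {set node S} -> elem -> elem ;
  assume_highest : onode S -> elem -> elem ;
  assign : cnode S -> elem -> elem ;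
  arelu : hnode S -> elem -> elem ;
  relu_status : hnode S -> elem -> option bool ;
  bassign : cnode S -> elem -> elem ;
  brelu : hnode S -> option bool -> elem -> elem ;
  gamma_top : forall s, gamma top (of_state s) ;
  gamma_bot : gamma bot = set0 ;
  gamma_meet : forall a a', gamma a `&` gamma a' `<=` gamma (meet a a') ;
  gamma_restrict : forall Z a s,
    gamma a (of_state s) -> Z s -> gamma (restrict Z a) (of_state s) ;
  gamma_project : forall D a t,
    gamma a t -> gamma (project D a) (pproj D t) ;
  gamma_assume_highest : forall j a s,
    gamma a (of_state s) -> (forall k, s (output k) <= s (output j)) ->
    gamma (assume_highest j a) (of_state s) ;
  gamma_assign : forall x a s, gamma a (of_state s) ->
    gamma (assign x a) (of_state (update s (node_of x) (preact M s x))) ;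
  gamma_arelu : forall (x : hnode S) a s, gamma a (of_state s) ->
    gamma (arelu x a)
      (of_state (update s (node_of (sval x)) (relu (s (node_of (sval x)))))) ;
  relu_statusP : forall (x : hnode S) a b s, relu_status x a = Some b ->
    gamma a (of_state s) -> has_status (s (node_of (sval x))) b ;
  gamma_bassign : forall x a s,
    gamma a (of_state (update s (node_of x) (preact M s x))) ->
    gamma (bassign x a) (of_state s) ;
  gamma_brelu : forall (x : hnode S) st a s,
    gamma a
      (of_state (update s (node_of (sval x)) (relu (s (node_of (sval x)))))) ->
    (forall b, st = Some b -> has_status (s (node_of (sval x))) b) ->
    gamma (brelu x st a) (of_state s) }.

Definition pattern : Type := {ffun hnode S -> option bool}.
Definition pattern_size (p : pattern) : nat := #|[set x | isSome (p x)]%SET|.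
Definition network_size : nat := #|{: hnode S}|.

Definition subsumed (p p' : pattern) : Prop :=
  forall x b, p' x = Some b -> p x = Some b.

Definition region : Type := set state.

Section Analysis.
Variables (M : network R S) (win : (onode S -> R) -> onode S).
Variables (K : {set inode S}) (Y : region) (A1 A2 : abstract_domain M).
Variables (region_size : region -> R) (L : R) (U : nat).

Definition forward_node (ap : A1 * pattern) (x : cnode S) : A1 * pattern :=
  let a := assign x ap.1 in
  if (insub x : option (hnode S)) is Some y then
    (arelu y a, [ffun z => if z == y then relu_status y a else ap.2 z])
  else (a, ap.2).

Definition forward (I : region) : A1 * pattern :=
  foldl forward_node (restrict I (top A1), [ffun => None]) (exec_order S).

Definition single_outcome (a : A1) : Prop :=
  exists j, forall s, gamma a (of_state s) -> win (output_values s) = j.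

(* A finite partition of I into parts cut out by conditions on the
   non-sensitive inputs only. *)
Definition nonsensitive_partition (I : region) (Q : set region) : Prop :=
  [/\ finite_set Q, partition Q id I &
      forall J, Q J -> exists P : set (inputs (~: K)),
        J = I `&` [set s | P (restr_inputs s)]].

(* F maps a pattern to its group of regions, empty if the pattern is not in
   the domain of F. *)
Definition groups : Type := pattern -> set region.

(* When p is not subsumed by a pattern of F, the groups of the patterns that
   p subsumes are moved under p. *)
Variant insert_group (F : groups) (p : pattern) (I : region) :
    groups -> Prop :=
| InsertOld p' of F p' !=set0 & subsumed p p' :
    insert_group F p I (fun q => if q == p' then I |` F p' else F q)
| InsertNew of (forall p', F p' !=set0 -> ~ subsumed p p') :
    insert_group F p I
      (fun q => if q == p then
                  I |` \bigcup_(r in [set r | subsumed r p]) F r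
                else if `[< subsumed q p >] then set0 else F q).

Record config := Config {
  worklist : set region ;
  feasible : groups ;
  excluded : set (pattern * region) ;
  completed : set region }.

Variant pre_step : config -> config -> Prop :=
| PreComplete P F E C I of P I & single_outcome (forward I).1 :
    pre_step (Config P F E C) (Config (P `\ I) F E (I |` C))
| PreFeasible P F E C I F' of P I & ~ single_outcome (forward I).1
    & (network_size - pattern_size (forward I).2 <= U)%N
    & insert_group F (forward I).2 I F' :
    pre_step (Config P F E C) (Config (P `\ I) F' E C)
| PreExclude P F E C I of P I & ~ single_outcome (forward I).1
    & (U < network_size - pattern_size (forward I).2)%N
    & region_size I <= L :
    pre_step (Config P F E C)
             (Config (P `\ I) F (((forward I).2, I) |` E) C)
| PreSplit P F E C I Q of P I & ~ single_outcome (forward I).1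
    & (U < network_size - pattern_size (forward I).2)%N
    & L < region_size I & nonsensitive_partition I Q :
    pre_step (Config P F E C) (Config ((P `\ I) `|` Q) F E C).

Definition init_config : config :=
  Config [set Y] (fun=> set0) set0 set0.

Definition backward_node (p : pattern) (x : cnode S) (a : A2) : A2 :=
  bassign x
    (if (insub x : option (hnode S)) is Some y then brelu y (p y) a else a).

Definition backward (p : pattern) (j : onode S) : A2 :=
  foldr (backward_node p) (assume_highest j (top A2)) (exec_order S).

Definition backward_on (p : pattern) (j : onode S) (I : region) : A2 :=
  project [set input k | k in ~: K]%SET (restrict I (backward p j)).

Definition biased (F : groups) : set A2 :=
  [set b | exists p I j j', [/\ F p I, j != j',
     b = meet (backward_on p j I) (backward_on p j' I) & b <> bot A2]].

(* [analyze (C, r, B, E)]: some run of the procedure, for some choices of the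
   regions removed from the worklist and of the partitions, returns
   (C, r, B, E). *)
Definition analyze
    (res : set region * bool * set A2 * set (pattern * region)) : Prop :=
  exists F E C,
    clos_refl_trans_1n config pre_step init_config (Config set0 F E C) /\
    res = (C `|` \bigcup_p F p, `[< biased F = set0 >], biased F, E).

End Analysis.

End Semantics.

Arguments sensitive_free {R S} K V Z.
Arguments unused {R S} win K V T.
Arguments causal_fairness {R S} win K V Z _.
Arguments analyze {R S M} win K Y A1 A2 region_size L U res.

(* Main.v *)
Require Import Defs.
From mathcomp Require Import all_boot all_order all_algebra.
From mathcomp Require Import boolp classical_sets cardinality reals.
From Stdlib Require Import Relation_Operators.

Set Implicit Arguments.
Unset Strict Implicit.
Unset Printing Implicit Defensive.

Import Order.TTheory GRing.Theory Num.Theory.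
Local Open Scope classical_set_scope.
Local Open Scope ring_scope.

(** All traces from [s] end in the same final state, the one obtained by
    computing every node in execution order, because computing a node does not
    alter the prescribed value of the nodes that precede it.  Splitting along
    the non-sensitive inputs keeps every region closed under changes of the
    sensitive inputs, so for [s] in a completed region [I] there is [s'] in [I]
    with the required sensitive value and the same non-sensitive inputs.  Either
    the forward analysis forces a single outcome on [I], or, if the outcomes
    [j] of [s] and [j'] of [s'] differed, the projection of [s] and [s'] to the
    non-sensitive inputs would lie in the meet of the backward results for [j]
    and [j'], which would then be a bias. *)

(** * Concrete executions as a deterministic function of the initial state *)

Section Execution.
Variables (R : realType) (S : arch) (M : network R S).
Implicit Types (s t : state R S) (x y : cnode S) (xs ys : seq (cnode S)).

(** Pairs with the same tag are related by reflexivity, all others by the order of their tags in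
    [s]. *)
Lemma pairwise_allpairs_tag (I : eqType) (T_ : I -> eqType) (r : rel I)
    (s : seq I) (t : forall i, seq (T_ i)) :
    reflexive r -> pairwise r s ->
  pairwise (fun u v => r (tag u) (tag v))
    [seq existT T_ i j | i <- s, j <- t i].
Proof.
move=> r_refl; elim: s => //= i s IHs /andP[/allP ri /IHs{}IHs].
rewrite pairwise_cat IHs andbT; apply/andP; split.
  elim: (t i) => //= j l IHl; rewrite allrel_consl IHl andbT.
  elim: s ri {IHs IHl} => //= i' s IHs ri.
  rewrite all_cat IHs => [|k ks]; last by apply: ri; rewrite inE ks orbT.
  by rewrite andbT all_map; apply/allP => k _ /=; apply: ri; rewrite inE eqxx.
elim: (t i) => //= j l ->; rewrite andbT all_map.
by apply/allP => k _ /=.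
Qed.

Lemma exec_order_uniq : uniq (exec_order S).
Proof.
apply: allpairs_uniq_dep => [|i _|]; rewrite ?enum_uniq //.
by case=> [i j] [i' j'] _ _ /= e; rewrite e.
Qed.

Lemma mem_exec_order x : x \in exec_order S.
Proof.
case: x => i j; apply/allpairsPdep; exists i, j.
by rewrite !mem_enum.
Qed.

Lemma exec_order_split xs x ys y :
    exec_order S = xs ++ x :: ys -> y \in xs ->
  y != x /\ (tag y <= tag x)%N.
Proof.
move=> e yxs; split.
  apply/eqP => yx; have := exec_order_uniq.
  by rewrite e cat_uniq /= -yx yxs !andbF.
have : pairwise (fun u v : cnode S => tag u <= tag v)%N (exec_order S).
  apply: (@pairwise_allpairs_tag _ _ (fun i k : 'I_(nhidden S).+1 => i <= k)%N).
    by move=> i /=.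
  rewrite -(pairwise_map val leq) val_enum_ord.
  by rewrite -(sorted_pairwise leq_trans) iota_sorted.
rewrite e pairwise_cat => /andP[/allrelP/(_ y x yxs) + _].
by apply; rewrite inE eqxx.
Qed.

Lemma node_of_inj : injective (@node_of S).
Proof.
move=> [[i lti] j] [[i' lti'] j'] /= e.
(* The predecessor undoes the shift made by [node_of], which sends tag [i] to layer [i.+1]. *)
have e1 : i = i' by exact: (congr1 (fun z : node S => (val (tag z)).-1) e).
subst i'; move: j' e; rewrite (bool_irrelevance lti' lti) => j' e.
by have /= -> := eq_from_Tagged e.
Qed.

(** Unlike [step], this does not ask the value to change, so it is a total function that can be
    folded over [exec_order]. *)
Definition compute s x : state R S := update s (node_of x) (node_value M s x).

(** The preactivation of [y] reads layer [tag y] only, whereas [node_of x] lies in layer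
    [(tag x).+1], which is strictly later. *)
Lemma preact_update s x y r : (tag y <= tag x)%N ->
  preact M (update s (node_of x) r) y = preact M s y.
Proof.
move=> yx; rewrite /preact; congr (_ + _); apply: eq_bigr => k _.
rewrite /update ifF //; apply/eqP => /(congr1 (fun z : node S => val (tag z))).
by move=> /= e; rewrite e ltnn in yx.
Qed.

Lemma preact_compute s x y : (tag y <= tag x)%N ->
  preact M (compute s x) y = preact M s y.
Proof. exact: preact_update. Qed.

Definition holds s x := s (node_of x) = node_value M s x.

Lemma compute_id s x : holds s x -> compute s x = s.
Proof.
move=> hx; apply/funext => z; rewrite /compute /update.
by case: eqP => // ->.
Qed.

Lemma holds_compute s x : holds (compute s x) x.
Proof.
by rewrite /holds /node_value preact_compute // /compute /update eqxx.
Qed.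

Lemma holds_compute_prefix xs x ys s :
    exec_order S = xs ++ x :: ys -> {in xs, forall y, holds s y} ->
  {in rcons xs x, forall y, holds (compute s x) y}.
Proof.
move=> e hxs y; rewrite mem_rcons inE => /predU1P[->|yxs].
  exact: holds_compute.
have [ynx yx] := exec_order_split e yxs.
rewrite /holds /node_value preact_compute // {1}/compute /update.
by rewrite (inj_eq node_of_inj) (negPf ynx); exact: hxs.
Qed.

Definition exec s : state R S := foldl compute s (exec_order S).

Lemma foldl_compute_id xs s :
  {in xs, forall y, holds s y} -> foldl compute s xs = s.
Proof.
elim: xs => //= x xs IHxs h.
rewrite compute_id; last by apply: h; rewrite inE eqxx.
by apply: IHxs => y yxs; apply: h; rewrite inE yxs orbT.
Qed.

(** Before and after the step the nodes of [xs] already hold their values, so both executions reduce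
    to computing [ys] from [compute s x]. *)
Lemma exec_step s t : step M s t -> exec t = exec s.
Proof.
move=> [xs [x [ys [e hxs _ ->]]]]; rewrite -/(compute s x) /exec e.
have h := holds_compute_prefix e hxs.
rewrite !foldl_cat /= (foldl_compute_id hxs) (@foldl_compute_id xs).
  by rewrite compute_id; last exact: holds_compute.
by move=> y yxs; apply: h; rewrite mem_rcons inE yxs orbT.
Qed.

Lemma final_holds s : final M s -> forall x, holds s x.
Proof.
move=> fs x; apply: contrapT => nhx.
(* The first node in execution order that violates [holds] would allow a step. *)
pose P y := ~~ `[< holds s y >].
have hasP : has P (exec_order S).
  by apply/hasP; exists x; rewrite ?mem_exec_order //; apply/asboolPn.
move el: (exec_order S) hasP => l hasP.
case/split_find: hasP el => y xs ys Py nP e.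
apply: (fs (compute s y)); exists xs, y, ys; split => //.
- by rewrite e cat_rcons.
- move=> z zxs; apply: contrapT => nz; move/hasPn: nP => /(_ z zxs).
  by move/negP; apply; apply/asboolPn.
- exact/asboolPn.
Qed.

Lemma holds_final s : (forall x, holds s x) -> final M s.
Proof. by move=> h t [xs [x [ys [_ _ nx _]]]]; exact/nx/h. Qed.

Lemma exec_last s l :
    path (fun s t => `[< step M s t >]) s l -> exec (last s l) = exec s.
Proof.
elim: l s => //= t l IHl s /andP[/asboolP st /IHl ->]; exact: exec_step.
Qed.

(** [exec] is constant along a trace and is the identity on a final state. *)
Lemma traces_last sigma :
  traces M sigma -> last_state sigma = exec (first_state sigma).
Proof.
move=> [ps fs]; rewrite -(exec_last ps).
by rewrite [RHS]foldl_compute_id // => y _; exact: final_holds.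
Qed.

Lemma traces_exists s : exists2 sigma, traces M sigma & first_state sigma = s.
Proof.
suff [l pl fl] : exists2 l, path (fun s t => `[< step M s t >]) s l &
    final M (last s l) by exists (s, l).
have : {in [::], forall y, holds s y} by [].
have : exec_order S = [::] ++ exec_order S by [].
(* Generalize to a prefix [xs] already correct and a remainder [ys]; a node of [ys] contributes a
   transition only when its value changes. *)
move: [::] {2}(exec_order S) => xs ys.
elim: ys xs s => [|x ys IHys] xs s e hxs.
  exists [::] => //=; apply: holds_final => x; apply: hxs.
  by have := mem_exec_order x; rewrite e cats0.
have h := holds_compute_prefix e hxs.
have e' : exec_order S = rcons xs x ++ ys by rewrite cat_rcons.
have [l pl fl] := IHys _ _ e' h.
have [hx|nhx] := pselect (holds s x).
  by exists l; rewrite compute_id in pl fl.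
exists (compute s x :: l) => //=; rewrite pl andbT; apply/asboolP.
by exists xs, x, ys.
Qed.

(** The nodes of [ys] lie in the layer of [x] or later ones, so the nodes feeding [x] are final once
    [x] is reached. *)
Lemma preact_foldl_compute xs x ys s : exec_order S = xs ++ x :: ys ->
  preact M (foldl compute s (x :: ys)) x = preact M s x.
Proof.
move=> e /=; rewrite -[RHS](preact_compute s (leqnn (tag x))).
have : {in ys, forall y, (tag x <= tag y)%N}.
  move=> y /splitPr yys; case: yys e => ys1 ys2.
  rewrite -cat_cons catA => /exec_order_split h.
  by have := h x; rewrite mem_cat inE eqxx orbT => /(_ isT)[].
elim: ys {e} (compute s x) => //= y ys IHys u h.
rewrite IHys ?preact_compute //; first by apply: h; rewrite inE eqxx.
by move=> z zys; apply: h; rewrite inE zys orbT.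
Qed.

(** The analyses treat a hidden node in two moves, an affine assignment and a ReLU; together they
    amount to one [compute]. *)
Lemma update_hidden s (y : hnode S) :
  let u := update s (node_of (val y)) (preact M s (val y)) in
  update u (node_of (val y)) (relu (u (node_of (val y)))) = compute s (val y).
Proof.
apply/funext => z; rewrite /compute /update eqxx /node_value (valP y).
by case: eqP.
Qed.

Lemma update_output s x : ~~ is_hidden x ->
  update s (node_of x) (preact M s x) = compute s x.
Proof. by move=> /negPf nx; rewrite /compute /node_value nx. Qed.

End Execution.

(** * Soundness of the forward and backward propagations *)

Section Soundness.
Variables (R : realType) (S : arch) (M : network R S).
Implicit Types (s : state R S) (I : region R S) (p : pattern S).

Definition follows p s : Prop :=
  forall y b, p y = Some b -> has_status (preact M (exec M s) (val y)) b.

Lemma forward_sound (A : abstract_domain M) I s : I s ->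
  gamma (forward A I).1 (of_state (exec M s)) /\ follows (forward A I).2 s.
Proof.
move=> Is; rewrite /forward.
(* Statuses are recorded only for the nodes [xs] already visited: later computations leave their
   preactivations unchanged, so the statuses persist until the final state. *)
pose inv (ap : A * pattern S) (xs : seq (cnode S)) u := gamma ap.1 (of_state u) /\
  forall y b, ap.2 y = Some b -> val y \in xs /\
    has_status (preact M u (val y)) b.
suff [? h] : inv (foldl (@forward_node R S M A) (restrict I (top A), [ffun => None])
    (exec_order S)) (exec_order S) (exec M s).
  by split=> // y b /h[].
have : inv (restrict I (top A), [ffun => None]) [::] s.
  split => [|y b]; last by rewrite ffunE.
  by apply: gamma_restrict => //; exact: gamma_top.
rewrite /exec; have : exec_order S = [::] ++ exec_order S by [].
rewrite -{4}[exec_order S]cat0s.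
move: (_, _) [::] {2 3 4 5}(exec_order S) s {Is} => ap xs ys.
elim: ys xs ap => [|x ys IHys] xs ap s e; first by rewrite cats0.
move=> [ga gp] /=; rewrite -cat_rcons; apply: IHys; first by rewrite cat_rcons.
have stable y b : ap.2 y = Some b -> val y \in rcons xs x /\
    has_status (preact M (compute M s x) (val y)) b.
  move=> /gp[yxs st]; rewrite mem_rcons inE yxs orbT; split => //.
  by rewrite preact_compute //; have [] := exec_order_split e yxs.
rewrite /forward_node; case: insubP => [y hx yE|nx]; last first.
  by split=> //=; rewrite -update_output //; exact: gamma_assign.
subst x; split=> /=.
  by rewrite -update_hidden; apply/gamma_arelu/gamma_assign.
move=> z b; rewrite ffunE; case: eqP => [-> st|_]; last exact: stable.
rewrite mem_rcons inE eqxx preact_compute //; split=> //.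
have := relu_statusP st (gamma_assign (val y) ga).
by rewrite /update eqxx.
Qed.

(** Induction on the nodes still to be computed: the final state is the same from [s] and from
    [compute s x], so [follows] passes to the induction hypothesis as it stands. *)
Lemma backward_sound (A : abstract_domain M) p j s : follows p s ->
    (forall k, exec M s (output k) <= exec M s (output j)) ->
  gamma (backward A p j) (of_state s).
Proof.
move=> fp hj; rewrite /backward.
have : gamma (assume_highest j (top A)) (of_state (exec M s)).
  by apply: gamma_assume_highest => //; exact: gamma_top.
move: (assume_highest _ _) => a {hj}; move: fp; rewrite /follows.
have : exec_order S = [::] ++ exec_order S by [].
rewrite /exec; move: [::] {2 3 4 5}(exec_order S) => xs ys.
elim: ys xs s => [|x ys IHys] xs s e // fp ga /=.
have {IHys} := IHys (rcons xs x) (compute M s x).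
rewrite cat_rcons => /(_ e fp ga) {}ga.
rewrite /backward_node; apply: gamma_bassign.
case: insubP => [y hx yE|nx]; last by rewrite update_output.
subst x; apply: gamma_brelu; first by rewrite update_hidden.
(* [p] constrains the preactivation in the final state, which equals the one in [s] when the ReLU is
   undone. *)
move=> b /fp; rewrite (preact_foldl_compute _ _ e).
by rewrite /update eqxx.
Qed.

Lemma backward_on_sound (A : abstract_domain M) (K : {set inode S}) p j I s :
    follows p s -> I s ->
    (forall k, exec M s (output k) <= exec M s (output j)) ->
  gamma (backward_on K A p j I)
    (pproj [set input k | k in ~: K]%SET (of_state s)).
Proof.
move=> fp Is hj; apply/gamma_project/gamma_restrict => //.
exact: backward_sound.
Qed.

Lemma pproj_eq_inputs (D : {set inode S}) s t : eq_inputs D s t ->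
  pproj [set input k | k in D]%SET (of_state s) =
  pproj [set input k | k in D]%SET (of_state t).
Proof.
move=> st; apply/funext => x; rewrite /pproj /of_state.
by case: imsetP => // -[k kD ->]; rewrite st.
Qed.

End Soundness.

(** * Invariants of the worklist loop *)

Section Run.
Variables (R : realType) (S : arch) (M : network R S).
Variables (win : (onode S -> R) -> onode S).
Variables (K : {set inode S}) (V : set (set (inputs R K))).
Variables (A : abstract_domain M).
Implicit Types (I J : region R S) (F : groups R S).

(** The witness found in [I] shares the non-sensitive inputs of [s], hence also satisfies [P]. *)
Lemma sensitive_free_part I J (P : set (inputs R (~: K))) :
    J = I `&` [set s | P (restr_inputs s)] ->
  sensitive_free K V I -> sensitive_free K V J.
Proof.
move=> -> free s [Is Ps] v Vv; have [t [It st vt]] := free s Is v Vv.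
exists t; split=> //; split=> //=.
suff -> : restr_inputs t = restr_inputs s :> inputs R (~: K) by [].
by apply/funext => k; rewrite /restr_inputs st //; exact: (svalP k).
Qed.

(** Subsumption ensures that executions from [I] follow the group's pattern [p], which may fix fewer
    statuses than the pattern computed for [I]. *)
Definition sound_groups F := forall p I, F p I ->
  sensitive_free K V I /\ subsumed (forward A I).2 p.

Definition sound_config (c : config R S) : Prop :=
  [/\ forall I, worklist c I -> sensitive_free K V I,
      sound_groups (feasible c)
    & forall I, completed c I ->
        sensitive_free K V I /\ single_outcome win (forward A I).1].

(** Regrouping preserves the invariant because subsumption is transitive. *)
Lemma insert_group_sound F p I F' : insert_group F p I F' ->
    sensitive_free K V I -> subsumed (forward A I).2 p ->
  sound_groups F -> sound_groups F'.
Proof.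
move=> ins freeI subI sF; case: ins => [p' _ sub|_] q J.
  case: eqP => [-> [->|]|_]; [|exact: sF..].
  by split=> // x b /sub/subI.
case: eqP => [-> [->//|[r /= sub /sF[freeJ subJ]]]|_].
  by split=> // x b /sub/subJ.
by case: asboolP => // _; exact: sF.
Qed.

Lemma pre_step_sound region_size (L : R) U c d :
    pre_step win K A region_size L U c d -> sound_config c -> sound_config d.
Proof.
case=> {c d} [P F E C I PI so|P F E C I F' PI _ _ ins|P F E C I PI _ _ _|
  P F E C I Q PI _ _ _ [_ _ part]] [/= sP sF sC]; split=> //=.
- by move=> J [/sP].
- by move=> J [->|/sC//]; split=> //; exact: sP.
- by move=> J [/sP].
- by apply: insert_group_sound ins _ _ sF; [exact: sP|move=> x b].
- by move=> J [/sP].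
- move=> J [[/sP//]|/part[P' JE]]; exact: sensitive_free_part JE (sP _ PI).
Qed.

Lemma run_sound region_size (L : R) U c d :
    clos_refl_trans_1n _ (pre_step win K A region_size L U) c d ->
  sound_config c -> sound_config d.
Proof. by elim=> // x y z /pre_step_sound xy _ yz /xy/yz. Qed.

End Run.

Theorem theorem9p1 (R : realType) (S : arch) (M : network R S)
    (win : (onode S -> R) -> onode S) (hwin : argmax_rule win)
    (K : {set inode S}) (V : set (set (inputs R K)))
    (hV : forall v, V v -> v !=set0)
    (Y : set (state R S)) (hY : sensitive_free K V Y)
    (A1 A2 : abstract_domain M)
    (region_size : set (state R S) -> R) (L : R) (U : nat)
    (C : set (set (state R S))) (E : set (pattern S * set (state R S)))
    (hrun : analyze win K Y A1 A2 region_size L U (C, true, set0, E)) :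
  let Z := \bigcup_(I in C) I in
  causal_fairness win K V Z (starting_in (traces M) Z) /\
  unused win K V (starting_in (traces M) Z).
Proof.
move=> Z; suff unusedZ : unused win K V (starting_in (traces M) Z).
  by split=> //; exists M.
case: hrun => F [E' [C' [run [CE _ BE _]]]].
have [|_ sF sC] := run_sound (V := V) run; first by split=> //= I ->.
move=> sigma [Tsigma [I CI Is]] v Vv _.
have freeI : sensitive_free K V I.
  by move: CI; rewrite CE => -[/sC[]|[p _ /sF[]]].
have [s' [Is' ss' vs']] := freeI _ Is v Vv.
have [sigma' Tsigma' s'E] := traces_exists M s'.
exists sigma'; rewrite s'E; split=> //.
  by split=> //; rewrite s'E; exists I.
rewrite /same_outcome (traces_last Tsigma) (traces_last Tsigma') s'E.
move: (first_state sigma) Is ss' => s Is ss'.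
move: CI; rewrite CE => -[/sC[_ [j so]]|[p _ FpI]].
  have [gs _] := forward_sound A1 Is; have [gs' _] := forward_sound A1 Is'.
  by rewrite !so.
have [_ sub] := sF _ _ FpI.
have followsI t : I t -> follows M p t.
  by move=> It y b /sub; exact: (forward_sound A1 It).2.
set j := win _; set j' := win _; apply: contrapT => /eqP jj'.
(* By [hwin] the winner has the highest output, as [assume_highest] requires. *)
have gs : gamma (backward_on K A2 p j I) _ :=
  backward_on_sound A2 K (followsI _ Is) Is (hwin _).
have gs' : gamma (backward_on K A2 p j' I) _ :=
  backward_on_sound A2 K (followsI _ Is') Is' (hwin _).
(* Both projections are the same partial state, which therefore lies in the meet. *)
rewrite -(pproj_eq_inputs ss') in gs'.
have gm := gamma_meet (conj gs gs').
set b := meet _ _ in gm.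
suff : set0 b by [].
(* The meet differs from [bot] since its concretization is inhabited, so it belongs to the empty set
   of biases. *)
rewrite BE; exists p, I, j, j'; split=> // b0.
by rewrite b0 gamma_bot in gm.
Qed.
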